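(* Let $C_5^-$ be the $3$-graph on vertex set $\{1,2,3,4,5\}$ with $3$-edges $123, 234, 345, 145$. For every positive integer $n$, $$\left\lfloor\frac n3\right\rfloor\le \mathrm{co^+ex}(n,C_5^-)\le \frac12 n .$$
   Context: A $3$-graph is a finite $3$-uniform hypergraph; an edge is written as the concatenation of its vertices. The minimum positive co-degree $\delta_2^+(H)$ of a non-empty $3$-graph $H$ is the maximum $k$ such that every pair of vertices contained in some edge of $H$ is contained in at least $k$ distinct edges of $H$; by convention it is $0$ if $H$ has no edges. A hypergraph is $F$-free if it has no (not necessarily induced) subhypergraph isomorphic to $F$. $\mathrm{co^+ex}(n,F)$ is the maximum of $\delta_2^+(H)$ over all $n$-vertex $F$-free $3$-graphs $H$. *)

(* Defs.v *)
From mathcomp Require Import all_boot all_order all_algebra.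
Set Implicit Arguments.
Unset Strict Implicit.
Unset Printing Implicit Defensive.

(* A hypergraph on the vertex set V is given by its edge set {set {set V}}. *)
Definition three_graph (V : finType) (H : {set {set V}}) : bool :=
  [forall e in H, #|e| == 3].

Definition codegree (V : finType) (H : {set {set V}}) (p : {set V}) : nat :=
  #|[set e in H | p \subset e]|.

Definition codegree_at_least (V : finType) (H : {set {set V}}) (k : nat) : bool :=
  [forall p : {set V},
     (#|p| == 2) && [exists e in H, p \subset e] ==> (k <= codegree H p)].

(* For a nonempty 3-graph the bound k <= #|H| is harmless, as some pair lies in
   an edge and no pair lies in more than #|H| edges.  For H = set0 the only
   candidate is k = 0, which yields the convention that the value is then 0. *)
Definition min_pos_codegree (V : finType) (H : {set {set V}}) : nat :=
  \max_(k < #|H|.+1 | codegree_at_least H k) k.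

Definition has_copy (W V : finType) (F : {set {set W}}) (H : {set {set V}}) : bool :=
  [exists f : {ffun W -> V}, injectiveb f && [forall e in F, f @: e \in H]].

Definition copos_ex (n : nat) (W : finType) (F : {set {set W}}) : nat :=
  \max_(H : {set {set 'I_n}} | three_graph H && ~~ has_copy F H)
     min_pos_codegree H.

(* The vertices 1, ..., 5 are the elements 0, ..., 4 of 'I_5. *)
Definition C5minus : {set {set 'I_5}} :=
  let v (i : nat) : 'I_5 := inord i.-1 in
  [set [set v 1; v 2; v 3]; [set v 2; v 3; v 4];
       [set v 3; v 4; v 5]; [set v 1; v 4; v 5]].

(* Main.v *)
Require Import Defs.
From mathcomp Require Import all_boot all_order all_algebra.
From mathcomp Require Import zify lra.
Import Order.TTheory GRing.Theory Num.Theory.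
Local Open Scope ring_scope.

(** Lower bound: in the complete 3-partite 3-graph with parts the residue
    classes modulo 3, every pair in an edge extends by a whole class, and
    [C5minus] is not 3-partite: the edges 123, 234, 345 force 1 and 4 into the
    same class, whereas 145 is an edge.
    Upper bound: if every positive co-degree exceeds n/2, then some pair 34 has
    two neighbours 2 and 5, and the pairs 23 and 45 have a common neighbour 1,
    which completes a copy of [C5minus]. *)

Section Hypergraph.
Set Implicit Arguments.
Unset Strict Implicit.
Variables (V : finType) (H : {set {set V}}).

Definition link (p : {set V}) : {set V} := [set v | (v \notin p) && (v |: p \in H)].

(** The map [v |-> v |: p] is a bijection from [link p] onto the edges containing [p]. Counting
    vertices instead of edges lets links of different pairs be intersected inside [V]. *)
Lemma codegree_link (p : {set V}) :
  three_graph H -> #|p| = 2%N -> codegree H p = #|link p|.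
Proof.
move=> /forall_inP H3 p2.
rewrite /codegree -(card_in_imset (f := fun v => v |: p) (D := link p)); last first.
  move=> v w; rewrite !inE => /andP[vp _] /andP[wp _] /setP /(_ v).
  by rewrite !inE eqxx (negPf vp) !orbF => /esym/eqP.
apply: eq_card => e; apply/idP/imsetP => [|[v + ->]]; rewrite !inE.
  case/andP=> eH pe.
  have /eqP e3 := H3 e eH.
  have /cards1P[v ev] : #|e :\: p| == 1%N by rewrite cardsDS // e3 p2.
  have Ee : e = v |: p by rewrite -ev setUC -{1}(setID e p) (setIidPr pe).
  exists v => //; rewrite inE -Ee eH andbT.
  by have := set11 v; rewrite -ev inE => /andP[].
by case/andP=> _ ->; rewrite subsetUr.
Qed.

Lemma three_graph_edge (e : {set V}) : three_graph H -> e \in H ->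
  exists x y z, [/\ e = [set x; y; z], x != y, x != z & y != z].
Proof.
move=> /forall_inP H3 /H3 /eqP e3.
have /card_gt0P[z ze] : (0 < #|e|)%N by rewrite e3.
have /cards2P[x [y [xy exy]]] : #|e :\ z| == 2%N.
  by move: e3; rewrite (cardsD1 z) ze => -[]/eqP.
have /setD1P[xz _] : x \in e :\ z by rewrite exy set21.
have /setD1P[yz _] : y \in e :\ z by rewrite exy set22.
by exists x, y, z; split=> //; rewrite -exy setUC setD1K.
Qed.

(** Two vertices of [e] form a pair lying in at least [k] edges. This places [k] within the index
    range of the maximum in [min_pos_codegree]. *)
Lemma codegree_at_least_leq_card (k : nat) (e : {set V}) :
  three_graph H -> e \in H -> codegree_at_least H k -> (k <= #|H|)%N.
Proof.
move=> H3 eH /forallP Hk.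
have [x [y [z [Ee xy xz yz]]]] := three_graph_edge H3 eH.
have /implyP/(_ _)/leq_trans := Hk [set x; y]; apply.
  rewrite cards2 xy /=; apply/existsP; exists e.
  by rewrite eH Ee subsetUl.
by apply: subset_leq_card; apply/subsetP => f; rewrite inE => /andP[].
Qed.

Lemma has_copy_C5minus_intro (a b c d e : V) : uniq [:: a; b; c; d; e] ->
  [set a; b; c] \in H -> [set b; c; d] \in H ->
  [set c; d; e] \in H -> [set a; d; e] \in H -> has_copy C5minus H.
Proof.
move=> us h1 h2 h3 h4; pose s := [:: a; b; c; d; e].
apply/existsP; exists [ffun i : 'I_5 => nth a s i]; apply/andP; split.
  apply/injectiveP => i j; rewrite !ffunE => /eqP.
  by rewrite nth_uniq // => /eqP/val_inj.
apply/forall_inP => f; rewrite !inE -!orbA.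
by case/or4P=> /eqP ->; rewrite !imsetU !imset_set1 !ffunE !inordK.
Qed.

Lemma C5minus_free_codegree (k : nat) (e : {set V}) :
  three_graph H -> ~~ has_copy C5minus H -> e \in H ->
  codegree_at_least H k -> (k.*2 <= #|V|)%N.
Proof.
move=> H3 free eH /forallP Hk; rewrite leqNgt; apply/negP => kV.
have deg x y z : x != y -> [set x; y; z] \in H -> (k <= #|link [set x; y]|)%N.
  move=> xy xyzH; rewrite -codegree_link ?cards2 ?xy //.
  apply: (implyP (Hk _)); rewrite cards2 xy; apply/existsP.
  by exists [set x; y; z]; rewrite xyzH subsetUl.
have [b [c [d [Ee bc bd cd]]]] := three_graph_edge H3 eH; rewrite Ee in eH.
(* With [kV] this forces [k >= 2], so the link of [cd] contains a vertex [a] besides [b]. *)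
have V3 : (3 <= #|V|)%N.
  by rewrite -(eqP (forall_inP H3 _ eH)) max_card.
have cdbH : [set c; d; b] \in H by rewrite setUC setUA.
have [a aP ab] : exists2 a, a \in link [set c; d] & a != b.
  have : (0 < #|link [set c; d] :\ b|)%N.
    have := cardsD1 b (link [set c; d]).
    have := deg _ _ _ cd cdbH; lia.
  by case/card_gt0P=> a; rewrite !inE => /andP[ab aP]; exists a; rewrite ?inE.
move: aP; rewrite !inE negb_or => /andP[/andP[ac ad] acdH].
have daH : [set d; a; c] \in H.
  by rewrite -setUA setUC -setUA.
have da : d != a by rewrite eq_sym.
(* Both links have at least [k] vertices and [2k > #|V|], so they meet. A common vertex avoids [b],
   [c], [d], [a], since a link excludes its own pair. *)
have [v] : exists v, v \in link [set b; c] :&: link [set d; a].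
  apply/card_gt0P.
  have := cardsUI (link [set b; c]) (link [set d; a]).
  have := subset_leq_card (subsetT (link [set b; c] :|: link [set d; a])); rewrite cardsT.
  have := deg _ _ _ bc eH; have := deg _ _ _ da daH; lia.
rewrite !inE !negb_or => /andP[/andP[/andP[vb vc] vbcH] /andP[/andP[vd va] vdaH]].
(* Here [v], [b], [c], [d], [a] play the vertices 1 to 5 in this order. *)
case/negP: free; apply: (@has_copy_C5minus_intro v b c d a) => //.
- by rewrite /= !inE !negb_or vb vc vd va bc bd (eq_sym b) ab cd (eq_sym c) ac da.
- by rewrite -setUA.
- by rewrite setUC.
- by rewrite -setUA.
Qed.

End Hypergraph.

Section Rainbow.
Set Implicit Arguments.
Unset Strict Implicit.
Variables (V : finType) (col : V -> 'I_3).

(** This is the complete 3-partite 3-graph whose parts are the colour classes of [col]. *)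
Definition rainbow : {set {set V}} := [set e : {set V} | (#|e| == 3%N) && (#|col @: e| == 3%N)].

Lemma rainbow_three_graph : three_graph rainbow.
Proof. by apply/forall_inP => e; rewrite inE => /andP[]. Qed.

Lemma rainbow_inj (e : {set V}) : e \in rainbow -> {in e &, injective col}.
Proof. by rewrite inE => /andP[/eqP e3 /eqP c3]; apply/imset_injP; rewrite c3 e3. Qed.

Lemma rainbow_C5minus_free : ~~ has_copy C5minus rainbow.
Proof.
apply/negP => /existsP[f /andP[/injectiveP finj /forall_inP fH]].
pose v (i : nat) : 'I_5 := inord i.-1.
pose c i : nat := col (f (v i)).
(* The range from 1 to 5 keeps [i.-1] and [inord] faithful, so different labels give different
   vertices. *)
have c_neq e i j : e \in C5minus -> v i \in e -> v j \in e ->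
    (0 < i < j)%N -> (j <= 5)%N -> c i != c j.
  move=> /fH /rainbow_inj einj ie je hij hj; apply/negP => /eqP/val_inj.
  move/(einj _ _ (imset_f _ ie) (imset_f _ je))/finj/(congr1 val).
  by rewrite /= !inordK; lia.
have c_edge i j k : (0 < i < j)%N -> (j < k <= 5)%N ->
    [set v i; v j; v k] \in C5minus -> [/\ c i != c j, c i != c k & c j != c k].
  by move=> hij hjk eC; split; apply: (c_neq _ _ _ eC); rewrite ?inE ?eqxx ?orbT //; lia.
have [] : [/\ c 1 != c 2, c 1 != c 3 & c 2 != c 3]%N.
  by apply: c_edge => //; rewrite !inE eqxx ?orbT.
have [] : [/\ c 2 != c 3, c 2 != c 4 & c 3 != c 4]%N.
  by apply: c_edge => //; rewrite !inE eqxx ?orbT.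
have [] : [/\ c 1 != c 4, c 1 != c 5 & c 4 != c 5]%N.
  by apply: c_edge => //; rewrite !inE eqxx ?orbT.
(* Vertices 1 and 4 both avoid the two distinct colours of 2 and 3. With three colours they agree,
   against the edge 145. *)
have c3 i : (c i < 3)%N := ltn_ord _.
have := c3 1%N; have := c3 2%N; have := c3 3%N; have := c3 4%N; lia.
Qed.

(** A pair inside a rainbow edge has two colours, and every vertex of the third colour completes it
    to an edge. *)
Lemma rainbow_codegree (k : nat) :
  (forall c, k <= #|[set v | col v == c]|)%N -> codegree_at_least rainbow k.
Proof.
move=> hk; apply/forallP => p; apply/implyP => /andP[/eqP p2 /exists_inP[e eH pe]].
rewrite codegree_link ?rainbow_three_graph //.
have pinj : {in p &, injective col}.
  by move=> x y xp yp; apply: (rainbow_inj eH); apply: (subsetP pe).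
have cp2 : #|col @: p| = 2%N by rewrite card_in_imset.
have [c cp] : exists c, c \notin col @: p.
  have /card_gt0P[c] : (0 < #|~: (col @: p)|)%N.
    by have := cardsC (col @: p); rewrite card_ord cp2 => /addnI ->.
  by rewrite inE; exists c.
apply: leq_trans (hk c) _; apply: subset_leq_card; apply/subsetP => w.
rewrite !inE => /eqP cw.
have wp : w \notin p by apply: contra cp => wp; rewrite -cw imset_f.
by rewrite wp imsetU1 !cardsU1 wp p2 cp2 cw cp.
Qed.

End Rainbow.

(** The numbers [j * 3 + c] with [j < n %/ 3] are distinct, lie below [n] and have residue [c]. *)
Lemma card_residue_class3 (n : nat) (c : 'I_3) :
  (n %/ 3 <= #|[set v : 'I_n | inord (v %% 3) == c]|)%N.
Proof.
have lt (j : 'I_(n %/ 3)) : (j * 3 + c < n)%N.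
  by have := ltn_ord j; have := ltn_ord c; lia.
pose g j := Ordinal (lt j).
have ginj : injective g by move=> i j /(congr1 val) /= ij; apply: val_inj => /=; lia.
rewrite -{1}(card_ord (n %/ 3)) -(card_imset _ ginj).
apply: subset_leq_card; apply/subsetP => _ /imsetP[j _ ->].
by rewrite inE /= modnMDl modn_small // inord_val.
Qed.

Theorem theorem15 (n : nat) (hn : (0 < n)%N) :
  (n %/ 3 <= copos_ex n C5minus)%N /\
  (copos_ex n C5minus)%:R <= 1 / 2 * n%:R :> rat.
Proof.
split.
  have [n3|n3] := ltnP n 3; first by rewrite divn_small.
  pose col (v : 'I_n) : 'I_3 := inord (v %% 3).
  have cal : codegree_at_least (rainbow col) (n %/ 3).
    by apply: rainbow_codegree; apply: card_residue_class3.
  pose x := widen_ord n3.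
  have colx i : col (x i) = i by rewrite /col /= modn_small // inord_val.
  (* The vertices 0, 1, 2 have distinct residues, so they form an edge and the graph is
     non-empty. *)
  have eH : x @: setT \in rainbow col.
    rewrite inE -imset_comp (eq_imset _ colx) imset_id.
    by rewrite card_imset ?cardsT ?card_ord //; apply: can_inj colx.
  have le := codegree_at_least_leq_card (rainbow_three_graph col) eH cal.
  rewrite /copos_ex.
  apply: (@bigop.bigmax_sup _ (rainbow col)).
    by rewrite rainbow_three_graph rainbow_C5minus_free.
  rewrite /min_pos_codegree.
  by rewrite -ltnS in le; apply: (@bigop.bigmax_sup _ (Ordinal le)).
have : ((copos_ex n C5minus).*2 <= n)%N.
  rewrite -geq_half_double; apply/bigop.bigmax_leqP => H /andP[H3 free].
  apply/bigop.bigmax_leqP => k kH; rewrite geq_half_double.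
  (* For empty [H] the index range leaves only [k = 0]. *)
  have [H0|[e eH]] := set_0Vmem H.
    by have := ltn_ord k; rewrite [in X in (_ < X)%N]H0 cards0; lia.
  by have := C5minus_free_codegree H3 free eH kH; rewrite card_ord.
rewrite -(ler_nat rat) -muln2 natrM; lra.
Qed.
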